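(* Let $K$ be a field with $\mathrm{char}\,K=p>0$ and let $(K(\vartheta)|K,v)$ be an Artin-Schreier extension of valued fields with Artin-Schreier generator $\vartheta$. If $\mathrm{dist}(\vartheta,K)\leq 0^-$ and $v(\vartheta-K)$ has no maximal element, then the extension of $v$ from $K$ to $K(\vartheta)$ is unique and $(K(\vartheta)|K,v)$ is immediate with defect $p$.
   Context: Valuations are Krull valuations of arbitrary rank, written additively; $vK$ is the value group and $Kv$ the residue field. An Artin-Schreier extension of a field of characteristic $p>0$ is a Galois extension of degree $p$; an Artin-Schreier generator of it is a generator $\vartheta$ with $\vartheta^p-\vartheta\in K$. An extension $(L|K,v)$ is immediate if the canonical embeddings $vK\to vL$ and $Kv\to Lv$ are onto. If $L|K$ is finite and $v$ extends uniquely from $K$ to $L$, the defect of $(L|K,v)$ is $[L:K]/\big((vL:vK)[Lv:Kv]\big)$. $v(a-K):=\{v(a-c)\mid c\in K\}$. A cut in a totally ordered set $T$ is a pair $(\Lambda^L,\Lambda^R)$ with $\Lambda^L$ an initial segment of $T$ and $\Lambda^R=T\setminus\Lambda^L$; cuts are compared by inclusion of their lower cut sets: $\Lambda_1\leq\Lambda_2$ iff $\Lambda_1^L\subseteq\Lambda_2^L$. For $S\subseteq T$, $S^+$ is the cut whose lower cut set is the least initial segment of $T$ containing $S$; for $s\in T$, $s^-$ is the cut with lower cut set $\{t\in T\mid t<s\}$. With $T=\widetilde{vK}$ the divisible hull of $vK$, $\mathrm{dist}(a,K):=(v(a-K)\cap\widetilde{vK})^+$. The cut $0^-$ is taken in $\widetilde{vK}$.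 *)

(* Defs.v *)
From HB Require Import structures.
From mathcomp Require Import all_boot all_order all_algebra all_field.
From mathcomp Require Import generic_quotient ring_quotient.
From mathcomp Require Import classical_sets.

Set Implicit Arguments.
Unset Strict Implicit.
Unset Printing Implicit Defensive.

Import Order.TTheory GRing.Theory Num.Theory.
Local Open Scope classical_set_scope.
Local Open Scope ring_scope.
Local Open Scope quotient_scope.

(* Totality is an axiom of the mixin, and the orderType structure is derived
   from it afterwards: a join of zmodType and orderType would lie below
   realDomainType, which HB rejects. *)
HB.mixin Record isOrderedAbelian G of Num.POrderedZmodule G := {
  oag_le_total : total (<=%R : rel G);
  oag_lerD2l : forall z : G, {homo +%R z : x y / x <= y}
}.

#[short(type="oagType")]
HB.structure Definition OrderedAbelian :=
  {G of isOrderedAbelian G & Num.POrderedZmodule G}.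

HB.instance Definition _ (G : oagType) :=
  Order.POrder_isTotal.Build ring_display (OrderedAbelian.sort G)
    (@oag_le_total G).

Section OrderedAbelianTheory.
Variable G : oagType.
Implicit Types x y z t : G.

Lemma oag_lerD2lE z x y : (z + x <= z + y) = (x <= y).
Proof.
apply/idP/idP => [/(oag_lerD2l (- z))|/(oag_lerD2l z)//].
by rewrite !addKr.
Qed.

Lemma oag_ltrD2lE z x y : (z + x < z + y) = (x < y).
Proof. by rewrite !ltNge oag_lerD2lE. Qed.

Lemma oag_lerD x y z t : x <= y -> z <= t -> x + z <= y + t.
Proof.
move=> xy zt; apply: (@le_trans _ _ (x + t)); first by rewrite oag_lerD2lE.
by rewrite ![_ + t]addrC oag_lerD2lE.
Qed.

Lemma oag_lerMn2r n x y : (x *+ n.+1 <= y *+ n.+1) = (x <= y).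
Proof.
have homo m a b : a <= b -> a *+ m <= b *+ m :> G.
  by move=> ab; elim: m => // m IH; rewrite !mulrS oag_lerD.
case: (leP x y) => [/homo -> //|yx]; apply/negbTE; rewrite -ltNge !mulrS.
apply: (@le_lt_trans _ _ (y + x *+ n)); first by rewrite oag_lerD2lE homo ?ltW.
by rewrite ![_ + x *+ n]addrC oag_ltrD2lE.
Qed.

Lemma oag_mulIn n : injective (fun x => x *+ n.+1).
Proof.
move=> x y /= exy; apply/eqP.
by rewrite eq_le -(oag_lerMn2r n) -(oag_lerMn2r n y) exy lexx.
Qed.

End OrderedAbelianTheory.

Module DivHull.
Section DivHull.
Variable G : oagType.

(* (g, n) stands for g / n.+1 *)
Implicit Types x y z : (G * nat)%type.

Definition hequiv x y := x.1 *+ y.2.+1 == y.1 *+ x.2.+1.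

Lemma hequiv_refl : reflexive hequiv. Proof. by move=> x; apply: eqxx. Qed.
Lemma hequiv_sym : symmetric hequiv.
Proof. by move=> x y; rewrite /hequiv eq_sym. Qed.
Lemma hequiv_trans : transitive hequiv.
Proof.
move=> y x z /eqP xy /eqP yz; apply/eqP/(@oag_mulIn _ y.2) => /=.
by rewrite mulrnAC xy mulrnAC yz mulrnAC.
Qed.

Canonical hequiv_equiv := EquivRel hequiv hequiv_refl hequiv_sym hequiv_trans.

Definition type := {eq_quot hequiv}.
#[export]
HB.instance Definition _ : EqQuotient _ hequiv type := EqQuotient.on type.
#[export]
HB.instance Definition _ := Choice.on type.

Lemma hequiv_repr x :
  (repr (\pi_type x)).1 *+ x.2.+1 = x.1 *+ (repr (\pi_type x)).2.+1.
Proof. by apply/eqP; rewrite -[_ == _]/(hequiv _ _) -eqmodE reprK. Qed.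

Definition zero : type := \pi_type (0, 0%N).

Definition oppf x := (- x.1, x.2).
Definition opp := lift_op1 type oppf.
Lemma pi_opp : {morph \pi : x / oppf x >-> opp x}.
Proof.
move=> x; unlock opp; apply/eqmodP; rewrite /= /hequiv /= !mulNrn.
by rewrite hequiv_repr.
Qed.
Canonical pi_opp_morph := PiMorph1 pi_opp.

Lemma addf_subproof (a a' b b' : G) (m m' n n' : nat) :
  a' *+ m = a *+ m' -> b' *+ n = b *+ n' ->
  (a *+ n + b *+ m) *+ (m' * n') = (a' *+ n' + b' *+ m') *+ (m * n).
Proof.
move=> ea eb; rewrite !mulrnDl -!mulrnA; congr (_ + _).
  rewrite (_ : n * (m' * n') = m' * (n * n'))%N; last by rewrite mulnCA.
  rewrite mulrnA -ea -mulrnA; congr (_ *+ _).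
  by rewrite [RHS]mulnC -mulnA.
rewrite (_ : m * (m' * n') = n' * (m * m'))%N; last by rewrite mulnA mulnC.
by rewrite mulrnA -eb -mulrnA; congr (_ *+ _); rewrite mulnCA mulnA mulnC mulnA.
Qed.

Definition addf x y :=
  (x.1 *+ y.2.+1 + y.1 *+ x.2.+1, (x.2.+1 * y.2.+1).-1%N).
Definition add := lift_op2 type addf.
Lemma pi_add : {morph \pi : x y / addf x y >-> add x y}.
Proof.
move=> x y; unlock add; apply/eqmodP.
rewrite /= /hequiv /addf /fst /snd !prednK ?muln_gt0 //.
by apply/eqP/addf_subproof; apply: hequiv_repr.
Qed.
Canonical pi_add_morph := PiMorph2 pi_add.

Lemma addf_A x y z : addf x (addf y z) = addf (addf x y) z.
Proof.
rewrite /addf /fst /snd !prednK ?muln_gt0 // mulnA; congr pair.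
move: x.2.+1 y.2.+1 z.2.+1 => m n k.
rewrite !mulrnDl -!mulrnA addrA.
by congr (_ + _ + _); congr (_ *+ _); rewrite mulnC.
Qed.

Lemma addA : associative add.
Proof.
elim/quotW=> x; elim/quotW=> y; elim/quotW=> z; rewrite !piE.
by rewrite addf_A.
Qed.

Lemma addC : commutative add.
Proof.
elim/quotW=> x; elim/quotW=> y; rewrite !piE.
by rewrite /addf addrC mulnC.
Qed.

Lemma add0 : left_id zero add.
Proof.
elim/quotW=> [[g n]]; rewrite /zero !piE /addf /fst /snd.
by rewrite mul0rn add0r mulr1n mul1n.
Qed.

Lemma addN : left_inverse zero opp add.
Proof.
elim/quotW=> x; rewrite /zero !piE; apply/eqmodP.
rewrite /= /hequiv /addf /oppf /fst /snd.
by rewrite mulNrn addNr !mul0rn.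
Qed.

#[export]
HB.instance Definition _ := GRing.isZmodule.Build type addA addC add0 addN.

Definition lef x y := x.1 *+ y.2.+1 <= y.1 *+ x.2.+1.
Definition le (a b : type) := lef (repr a) (repr b).
Definition lt (a b : type) := (b != a) && le a b.

Lemma lef_trans : transitive lef.
Proof.
move=> y x z; rewrite /lef -(oag_lerMn2r z.2) => xy.
rewrite -(oag_lerMn2r x.2) => yz; rewrite -(oag_lerMn2r y.2).
apply: le_trans (_ : y.1 *+ x.2.+1 *+ z.2.+1 <= _).
  by rewrite mulrnAC.
by rewrite mulrnAC (mulrnAC z.1).
Qed.

Lemma pi_le x y : le (\pi x) (\pi y) = lef x y.
Proof.
have ex u : lef (repr (\pi_type u)) u by rewrite /lef hequiv_repr.
have ex' u : lef u (repr (\pi_type u)) by rewrite /lef hequiv_repr.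
apply/idP/idP => [h|h].
  exact: lef_trans (lef_trans (ex' _) h) (ex _).
exact: lef_trans (lef_trans (ex _) h) (ex' _).
Qed.

Lemma le_anti : antisymmetric le.
Proof.
elim/quotW=> x; elim/quotW=> y; rewrite !pi_le /lef => xy.
by apply/eqmodP; rewrite /= /hequiv eq_le.
Qed.

Lemma le_trans : transitive le.
Proof. by move=> y x z; apply: lef_trans. Qed.

Lemma le_refl : reflexive le.
Proof. by move=> x; rewrite /le /lef lexx. Qed.

Lemma lt_def a b : lt a b = (b != a) && le a b. Proof. by []. Qed.

#[export]
HB.instance Definition _ :=
  Order.isPOrder.Build ring_display type lt_def le_refl le_anti le_trans.

Lemma le_total : total (<=%R : rel type).
Proof. by move=> a b; apply: oag_le_total. Qed.

Lemma addf_le (a b c : G) (m n k : nat) : a *+ n <= b *+ m ->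
  (c *+ m + a *+ k.+1) *+ (k.+1 * n) <= (c *+ n + b *+ k.+1) *+ (k.+1 * m).
Proof.
move=> ab; rewrite !mulrnDl -!mulrnA.
rewrite (_ : n * (k.+1 * m) = m * (k.+1 * n))%N; last first.
  by rewrite mulnCA (mulnC n) mulnCA.
rewrite oag_lerD2lE ![(k.+1 * (k.+1 * _))%N]mulnA.
by rewrite ![(k.+1 * k.+1 * _)%N]mulnC !mulrnA !oag_lerMn2r.
Qed.

Lemma le_add (c : type) : {homo +%R c : a b / a <= b}.
Proof.
elim/quotW: c => z; elim/quotW=> x; elim/quotW=> y.
rewrite -[_ <= _]/(le _ _) -[_ + _ <= _]/(le (add _ _) (add _ _)).
rewrite -!pi_add !pi_le /lef /addf /fst /snd !prednK ?muln_gt0 //.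
exact: addf_le.
Qed.

#[export]
HB.instance Definition _ := isOrderedAbelian.Build type le_total le_add.
#[export]
HB.instance Definition _ :=
  Order.POrder_isTotal.Build ring_display type le_total.

End DivHull.

Module Exports. HB.reexport. End Exports.
End DivHull.
Export DivHull.Exports.

Notation divhull := DivHull.type.

Section DivHullTheory.
Variable G : oagType.

Definition inhull (g : G) : divhull G := \pi_(divhull G) (g, 0%N).

Lemma inhull_is_zmod_morphism : zmod_morphism inhull.
Proof.
move=> x y; rewrite /inhull -[RHS]/(DivHull.add _ (DivHull.opp _)).
by rewrite -DivHull.pi_opp -DivHull.pi_add /DivHull.addf /DivHull.oppf.
Qed.
HB.instance Definition _ :=
  GRing.isZmodMorphism.Build G (divhull G) inhull inhull_is_zmod_morphism.

Lemma inhull_le : {mono inhull : x y / x <= y}.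
Proof. by move=> x y; apply: (DivHull.pi_le (x, 0%N) (y, 0%N)). Qed.

Lemma pi_divhullMn (g : G) n m :
  \pi_(divhull G) (g, n) *+ m = \pi_(divhull G) (g *+ m, n).
Proof.
elim: m => [|m IH].
  by apply/eqmodP; rewrite /= /DivHull.hequiv /= !mul0rn.
rewrite mulrS IH -[LHS]/(DivHull.add _ _) -DivHull.pi_add; apply/eqmodP.
rewrite /= /DivHull.hequiv /DivHull.addf /fst /snd prednK ?muln_gt0 //.
by rewrite -mulrnDl -mulrS mulrnA.
Qed.

Lemma divhull_torsion (a : divhull G) : exists n g, a *+ n.+1 = inhull g.
Proof.
elim/quotW: a => -[g n]; exists n, g; rewrite pi_divhullMn.
by apply/eqmodP; rewrite /= /DivHull.hequiv /fst /snd mulr1n.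
Qed.

Lemma divhull_divisible n (a : divhull G) : exists b, b *+ n.+1 = a.
Proof.
elim/quotW: a => -[g k].
have [D ED] : exists D, D.+1 = (k.+1 * n.+1)%N.
  by exists (k.+1 * n.+1).-1; rewrite prednK ?muln_gt0.
exists (\pi_(divhull G) (g, D)).
rewrite pi_divhullMn; apply/eqmodP; rewrite /= /DivHull.hequiv /fst /snd.
by rewrite ED -mulrnA mulnC.
Qed.

(* The divisible hull of a subgroup H of G, as a subgroup of that of G. *)
Definition hull_of (H : set G) : set (divhull G) :=
  [set a | exists n : nat, exists2 h, H h & a *+ n.+1 = inhull h].

End DivHullTheory.

Section Cuts.
Context {d : Order.disp_t} {X : orderType d}.

Definition initial_segment (T A : set X) :=
  A `<=` T /\ forall s t, T s -> A t -> (s <= t)%O -> A s.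

Record cut (T : set X) :=
  Cut { lower_cut :> set X; lower_cutP : initial_segment T lower_cut }.

Definition upper_cut T (c : cut T) : set X := T `\` c.

Definition cut_le T (c1 c2 : cut T) := lower_cut c1 `<=` lower_cut c2.

Lemma plus_cut_subproof (T S : set X) :
  initial_segment T [set t | T t /\
    forall A, initial_segment T A -> S `<=` A -> A t].
Proof.
split=> [t []//|s t Ts [Tt At] st]; split=> // A hA SA.
exact: hA.2 Ts (At A hA SA) st.
Qed.
(* S^+, for S included in T *)
Definition plus_cut (T S : set X) : cut T := Cut (plus_cut_subproof T S).

Lemma minus_cut_subproof (T : set X) s :
  initial_segment T [set t | T t /\ (t < s)%O].
Proof.
split=> [t []//|r t Tr [_ ts] rt]; split=> //.
exact: le_lt_trans rt ts.
Qed.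
(* s^-, for s in T *)
Definition minus_cut (T : set X) s : cut T := Cut (minus_cut_subproof T s).

End Cuts.

Definition has_maximal {d} {X : porderType d} (S : set X) :=
  exists2 m, S m & forall s, S s -> ~ (m < s)%O.

Definition withinf (G : oagType) := option G.
HB.instance Definition _ (G : oagType) := Choice.on (withinf G).

Section WithInf.
Variable G : oagType.
Implicit Types a b c : withinf G.

Definition fin (g : G) : withinf G := Some g.
Definition winf : withinf G := None.

Definition wle a b : bool :=
  match a, b with
  | _, None => true
  | None, Some _ => false
  | Some x, Some y => x <= y
  end.
Definition wlt a b := (b != a) && wle a b.

Lemma wlt_def a b : wlt a b = (b != a) && wle a b. Proof. by []. Qed.
Lemma wle_refl : reflexive wle. Proof. by case=> /=. Qed.
Lemma wle_anti : antisymmetric wle.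
Proof. by case=> [x|] [y|] //= /le_anti ->. Qed.
Lemma wle_trans : transitive wle.
Proof. by case=> [x|] [y|] [z|] //=; apply: le_trans. Qed.

HB.instance Definition _ :=
  Order.isPOrder.Build ring_display (withinf G)
    wlt_def wle_refl wle_anti wle_trans.

Lemma wle_total : total (<=%R : rel (withinf G)).
Proof. by case=> [x|] [y|] //; apply: oag_le_total. Qed.
HB.instance Definition _ :=
  Order.POrder_isTotal.Build ring_display (withinf G) wle_total.

Definition wadd a b : withinf G :=
  match a, b with Some x, Some y => fin (x + y) | _, _ => winf end.

Lemma fin_le x y : (fin x <= fin y) = (x <= y). Proof. by []. Qed.
Lemma fin_lt x y : (fin x < fin y) = (x < y).
Proof. by rewrite !ltNge. Qed.
Lemma le_winf a : a <= winf. Proof. by case: a. Qed.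

End WithInf.
Arguments winf {G}.
Arguments fin {G}.

Record valuation (F : fieldType) (G : oagType) := Valuation {
  val_fun :> F -> withinf G;
  val_eqinf : forall x, val_fun x = winf <-> x = 0;
  valM : forall x y, val_fun (x * y) = wadd (val_fun x) (val_fun y);
  valD : forall x y, Order.min (val_fun x) (val_fun y) <= val_fun (x + y)
}.

Section ValuationRing.
Variables (F : fieldType) (G : oagType) (v : valuation F G).

Lemma val0 : v 0 = winf. Proof. exact/val_eqinf. Qed.

Lemma val_fin x : x != 0 -> exists g, v x = fin g.
Proof.
move=> /eqP x0; case E: (v x) => [g|]; first by exists g.
by case: x0; apply/(val_eqinf v).
Qed.

Lemma val1 : v 1 = fin 0.
Proof.
have [g E] := val_fin (oner_neq0 F).
have := valM v 1 1; rewrite mulr1 E => -[/(congr1 (fun z => z - g))].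
by rewrite subrr addrK => <-.
Qed.

Lemma valN x : v (- x) = v x.
Proof.
suff E1 : v (-1) = fin 0.
  by rewrite -mulN1r valM E1; case: (v x) => //= g; rewrite add0r.
have m1 : -1 != 0 :> F by rewrite oppr_eq0 oner_eq0.
have [g E] := val_fin m1.
have := valM v (-1) (-1); rewrite mulrNN mulr1 val1 E => -[/esym g2].
congr fin; apply: (@oag_mulIn _ 1%N) => /=.
by rewrite mulr2n g2 mul0rn.
Qed.

Definition vring_pred : {pred F} := [pred x | fin 0 <= v x].

Lemma vring_closed : subring_closed vring_pred.
Proof.
split=> [|x y|x y]; rewrite !inE ?val1 ?lexx // => hx hy.
  by apply: le_trans (valD v x (- y)); rewrite valN le_min hx.
rewrite valM; case: (v x) (v y) hx hy => [a|] [b|] //.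
by rewrite !fin_le => *; rewrite -[0]addr0 oag_lerD.
Qed.
HB.instance Definition _ := GRing.isSubringClosed.Build F vring_pred vring_closed.

Record vring := VRing { vring_val :> F; vring_valP : vring_val \in vring_pred }.
HB.instance Definition _ := [isSub for vring_val].
HB.instance Definition _ := [Choice of vring by <:].
HB.instance Definition _ := [SubChoice_isSubComNzRing of vring by <:].

Definition vmax : {pred vring} := [pred x | fin 0 < v (vring_val x)].

Lemma vmax_idealr : idealr_closed vmax.
Proof.
split; rewrite ?inE /= ?rmorph0 ?rmorph1 ?val0 ?val1 ?ltxx //.
move=> a x y; rewrite !inE /= => hx hy.
apply: lt_le_trans (valD v _ _); rewrite lt_min hy andbT valM.
have := vring_valP a; rewrite inE.
case: (v (vring_val a)) => [g|] //; case: (v (vring_val x)) hx => [h|] //.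
rewrite fin_le !fin_lt => h0 g0; apply: lt_le_trans h0 _.
by rewrite -[X in X <= _]add0r oag_lerD.
Qed.
HB.instance Definition _ := isIdealr.Build vring vmax vmax_idealr.

Lemma vmaxE (x : vring) : (x \in vmax) = (fin 0 < v (vring_val x)).
Proof. by []. Qed.

Definition resfield := {ideal_quot vmax}.
HB.instance Definition _ := GRing.ComNzRing.on resfield.
HB.instance Definition _ := Choice.on resfield.

Definition residue (x : vring) : resfield := \pi_resfield x.
HB.instance Definition _ := GRing.RMorphism.copy residue (\pi_resfield).

Lemma residue_eq0 x : (residue x == 0) = (x \in vmax).
Proof. by rewrite -[X in X \in _]subr0 Quotient.idealrBE -/(residue x) pi_zeror. Qed.

Lemma val_unit (x : vring) : x \notin vmax -> v (vring_val x) = fin 0.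
Proof.
have := vring_valP x; rewrite inE vmaxE -leNgt => h1 h2.
by apply/eqP; rewrite eq_le h1 h2.
Qed.

Lemma valV_unit x : v x = fin 0 -> x^-1 \in vring_pred.
Proof.
move=> vx; have x0 : x != 0.
  by apply/eqP => x0; move: vx; rewrite x0 val0.
have := valM v x x^-1; rewrite mulfV // val1 vx inE.
by case: (v x^-1) => //= g []; rewrite add0r => <-.
Qed.

Definition vring_inv (x : vring) : vring :=
  insubd (0 : vring) (vring_val x)^-1.

Definition resfield_inv (a : resfield) : resfield :=
  if a == 0 then 0 else residue (vring_inv (repr a)).

Lemma resfield_mulV a : a != 0 -> resfield_inv a * a = 1.
Proof.
move=> a0; rewrite /resfield_inv (negbTE a0).
move: (a0); rewrite -[a in a != 0]reprK -/(residue _) residue_eq0 => ua.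
rewrite -[a in _ * a]reprK -/(residue _) -rmorphM -(rmorph1 residue).
congr residue; apply: val_inj; rewrite /= /vring_inv insubdK; last first.
  exact/valV_unit/val_unit.
rewrite mulVf //; apply/eqP => x0; move: (val_unit ua).
by rewrite x0 val0.
Qed.

Lemma resfield_inv0 : resfield_inv 0 = 0.
Proof. by rewrite /resfield_inv eqxx. Qed.

HB.instance Definition _ :=
  GRing.ComNzRing_isField.Build resfield resfield_mulV resfield_inv0.

Definition value_group : set G := [set g | exists x, v x = fin g].

End ValuationRing.
Arguments residue {F G} v x.

(* Equivalent valuations, i.e. equal up to an ordered isomorphism of their
   value groups, are those with the same valuation ring. *)
Definition val_equiv (F : fieldType) (G G' : oagType)
    (v : valuation F G) (w : valuation F G') :=
  vring_pred v =i vring_pred w.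

Section Restriction.
Variables (K L : fieldType) (f : {rmorphism K -> L}).
Variables (G : oagType) (v : valuation L G).

Lemma val_restr_eqinf x : v (f x) = winf <-> x = 0.
Proof.
split=> [/(val_eqinf v)/eqP|->]; last by rewrite rmorph0 val0.
by rewrite fmorph_eq0 => /eqP.
Qed.
Lemma val_restrM x y : v (f (x * y)) = wadd (v (f x)) (v (f y)).
Proof. by rewrite rmorphM valM. Qed.
Lemma val_restrD x y : Order.min (v (f x)) (v (f y)) <= v (f (x + y)).
Proof. by rewrite rmorphD valD. Qed.
Definition val_restr : valuation K G :=
  Valuation val_restr_eqinf val_restrM val_restrD.

Definition vring_map (x : vring val_restr) : vring v :=
  @VRing L G v (f (vring_val x)) (vring_valP x).

Lemma vring_map_zmod : zmod_morphism vring_map.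
Proof. by move=> x y; apply: val_inj; rewrite /= rmorphB. Qed.
Lemma vring_map_monoid : monoid_morphism vring_map.
Proof. by split=> [|x y]; apply: val_inj; rewrite /= ?rmorph1 ?rmorphM. Qed.
HB.instance Definition _ :=
  GRing.isZmodMorphism.Build _ _ vring_map vring_map_zmod.
HB.instance Definition _ :=
  GRing.isMonoidMorphism.Build _ _ vring_map vring_map_monoid.

Definition resfield_map (a : resfield val_restr) : resfield v :=
  residue v (vring_map (repr a)).

Lemma resfield_mapE x :
  resfield_map (residue val_restr x) = residue v (vring_map x).
Proof.
apply/eqP; rewrite -subr_eq0 -!rmorphB residue_eq0 inE /=.
have : residue val_restr (repr (residue val_restr x) - x) == 0.
  by rewrite rmorphB /= {1}/residue reprK subrr.
by rewrite residue_eq0 inE.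
Qed.

Lemma resfield_map_zmod : zmod_morphism resfield_map.
Proof.
elim/quotW=> x; elim/quotW=> y.
by rewrite -!/(residue _ _) -rmorphB !resfield_mapE !rmorphB.
Qed.
Lemma resfield_map_monoid : monoid_morphism resfield_map.
Proof.
split; first by rewrite -(rmorph1 (residue val_restr)) resfield_mapE !rmorph1.
elim/quotW=> x; elim/quotW=> y.
by rewrite -!/(residue _ _) -rmorphM !resfield_mapE !rmorphM.
Qed.
HB.instance Definition _ :=
  GRing.isZmodMorphism.Build _ _ resfield_map resfield_map_zmod.
HB.instance Definition _ :=
  GRing.isMonoidMorphism.Build _ _ resfield_map resfield_map_monoid.

End Restriction.
Arguments resfield_map {K L} f {G} v a.

(* (B : A) = n, for subgroups A included in B: the r i form a system of
   representatives of the cosets of A in B. *)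
Definition group_index (V : zmodType) (A B : set V) (n : nat) :=
  exists2 r : 'I_n -> V, forall i, B (r i) &
    forall b, B b -> exists! i, A (b - r i).

(* [E : f(F)] = n: the b i form a basis of E over f(F). *)
Definition field_degree (F E : fieldType) (f : {rmorphism F -> E}) (n : nat) :=
  exists b : 'I_n -> E,
    forall y, exists! c : {ffun 'I_n -> F}, y = \sum_(i < n) f (c i) * b i.

Section ValuedExtension.
Variables (K : fieldType) (L : fieldExtType K) (G : oagType).
Variable v : valuation L G.

Definition val_base : valuation K G := val_restr (in_alg L) v.

Definition immediate :=
  value_group v `<=` value_group val_base /\
  forall b : resfield v, exists a, resfield_map (in_alg L) v a = b.

(* Uniqueness up to equivalence of valuations. *)
Definition unique_extension :=
  forall (G' : oagType) (w : valuation L G'),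
    val_equiv (val_restr (in_alg L) w) val_base -> val_equiv w v.

(* Meaningful when the extension of v from K to L is unique. *)
Definition is_defect (d : rat) :=
  exists e n : nat,
    [/\ group_index (value_group val_base) (value_group v) e,
        field_degree (resfield_map (in_alg L) v) n
      & d = (\dim {:L})%:R / (e * n)%:R].

Definition diff_values (a : L) : set (withinf G) :=
  [set v (a - c%:A) | c in [set: K]].

(* The divisible hull of vK, inside that of G. *)
Definition hull_base : set (divhull G) := hull_of (value_group val_base).

(* The cut (v(a-K) `&` T)^+ in T, the divisible hull of vK. The value +oo, which
   is not in T, is dropped from v(a-K). *)
Definition dist (a : L) : cut hull_base :=
  plus_cut hull_base
    ([set inhull g | g in [set g | diff_values a (fin g)]] `&` hull_base).

End ValuedExtension.

Definition artin_schreier_extension (p : nat) (K : fieldType)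
    (L : splittingFieldType K) :=
  [/\ p \in [pchar K], galois 1 {:L} & \dim {:L} = p].

Definition artin_schreier_generator (p : nat) (K : fieldType)
    (L : splittingFieldType K) (theta : L) :=
  <<1; theta>>%VS = {:L}%VS /\ theta ^+ p - theta \in 1%VS.

(* Main.v *)
Require Import Defs.
From mathcomp Require Import all_boot all_order all_algebra all_field.
From mathcomp Require Import classical_sets ring.

Import Order.TTheory GRing.Theory.
Local Open Scope ring_scope.

Set Implicit Arguments.
Unset Strict Implicit.
Unset Printing Implicit Defensive.

(** Write [t c = c - theta] for [c] in [K]. Since [v (theta - K)] has no
    maximum, [theta] is a pseudo-limit of elements of [K], and one studies how
    functions of [c] behave as [v (t c)] increases. The key fact
    ([leading_small]) is that, for every nonzero polynomial [f] over [K] of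
    degree less than [p], [f(c)] is ultimately so close to [f(theta)] that
    [v (f(c) - f(theta)) > v (f(theta))]. Every nonzero [y] in [L] is such an
    [f(theta)], so it is approximated by some [x] in [K] with [v (x - y) > v y].
    Hence [v y = v x], and if [v y = 0] both have the same residue: the
    extension is immediate, and its defect is its degree.

    To prove the key fact, expand [f(c)] by Taylor's formula in powers of
    [t c]. The values of the terms [a_i * t c ^ i] are affine functions of
    [v (t c)] with distinct slopes [i], so one of them is ultimately the
    strict minimum ([ultimately_unique_min]): [f(c)] has a leading term
    [a_h * t c ^ h]. The exponent [h], written h(f) here, is unique, additive on
    products, and at most the degree of [f]; one has to show h(f) = 0 when
    [0 < deg f < p]. Three observations suffice.
    - h(f) is not [deg f]: the coefficient of the Taylor expansion in degree
      [deg f - 1] is, up to a factor of value that of the leading coefficient,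
      [t e] for some [e] in [K], and [v (t c)] ultimately exceeds [v (t e)].
    - The Artin-Schreier polynomial [P = X^p - X - a] has h(P) = p, because
      [P(c) = t c ^ p - t c] and [v (t c) < 0].
    - Dividing, [P = q f + r] with [deg r < deg f], where h(r) = 0 by induction.
      If h(f) > 0, the leading exponent of [P] is h(q) + h(f) or 0; but
      h(q) + h(f) < (p - deg f) + deg f = p, a contradiction.

    For uniqueness, let [w] be another extension. From [v (t c) < 0] one gets
    [v (t c ^ p) = v (t c ^ p - t c)] and [t c ^ p - t c] lies in [K], where [v]
    and [w] agree. So [w (t c) < 0] too and [w] orders the [t c] as [v] does;
    then [w] satisfies the hypotheses made on [v], and one [c] makes [f(c)]
    an approximation of [f(theta)] for both. Hence [f(theta)] has nonnegative
    value for [w] exactly when it has for [v]. *)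

(** * Valuations and inequalities *)

Section ValuationInequalities.
Variables (F : fieldType) (G : oagType) (v : valuation F G).
Implicit Types x y z : F.

Lemma val_le_mul2l z x y : z != 0 -> (v (z * x) <= v (z * y)) = (v x <= v y).
Proof.
case/(val_fin v) => g Eg; rewrite !Defs.valM Eg.
by case: (v x) (v y) => [a|] [b|] //=; rewrite fin_le oag_lerD2lE.
Qed.

Lemma val_lt_mul2l z x y : z != 0 -> (v (z * x) < v (z * y)) = (v x < v y).
Proof. by move=> z0; rewrite !ltNge val_le_mul2l. Qed.

Lemma val_lt_neq0 x y : v x < v y -> x != 0.
Proof. by apply: contraTneq => ->; rewrite val0 -leNgt le_winf. Qed.

Lemma val_leX n x y : v x <= v y -> v (x ^+ n) <= v (y ^+ n).
Proof.
move=> xy; have [->|x0] := eqVneq y 0.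
  case: n => [|n]; first by rewrite !expr0.
  by rewrite [0 ^+ _]expr0n val0 le_winf.
elim: n => [|n IH]; first by rewrite !expr0.
rewrite !exprS; have [x00|xN0] := eqVneq x 0.
  by move: xy; rewrite x00 val0; case/(val_fin v): x0 => g ->.
rewrite (@le_trans _ _ (v (x * y ^+ n))) ?val_le_mul2l //.
by rewrite ![_ * y ^+ n]mulrC val_le_mul2l // expf_neq0.
Qed.

Lemma val_ltX n x y : v x < v y -> v (x ^+ n.+1) < v (y ^+ n.+1).
Proof.
move=> xy; have x0 := val_lt_neq0 xy.
rewrite !exprS [y * _]mulrC (@lt_le_trans _ _ (v (x ^+ n * y))) //.
  by rewrite [x * _]mulrC val_lt_mul2l ?expf_neq0.
by rewrite ![_ * y]mulrC; have [->|y0] := eqVneq y 0;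
  rewrite ?mul0r // val_le_mul2l // val_leX // ltW.
Qed.

Lemma val_le_expS n x y : (v (x ^+ n.+1) <= v (y ^+ n.+1)) = (v x <= v y).
Proof.
apply/idP/idP => [|/val_leX]; last exact.
by apply: contraTT; rewrite -!ltNge; apply: val_ltX.
Qed.

Lemma val_ltD a x y : a < v x -> a < v y -> a < v (x + y).
Proof. by move=> ax ay; apply: lt_le_trans (valD v x y); rewrite lt_min ax. Qed.

Lemma val_lt_sum (I : Type) (r : seq I) (P : pred I) (E : I -> F) a :
  a < winf -> (forall i, P i -> a < v (E i)) -> a < v (\sum_(i <- r | P i) E i).
Proof.
move=> a_fin ltE; apply: (big_ind (fun x => a < v x)) => //.
  by rewrite val0.
exact: val_ltD.
Qed.

Lemma val_dominant x y : v x < v (y - x) -> v y = v x.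
Proof.
move=> h; apply/eqP; rewrite eq_le; apply/andP; split; last first.
  have := valD v x (y - x); rewrite [x + _]addrC subrK.
  by apply: le_trans; rewrite le_min lexx ltW.
rewrite leNgt; apply/negP => xy.
have : v x < v (y - (y - x)) by apply: val_ltD; rewrite ?Defs.valN.
by rewrite subKr ltxx.
Qed.

End ValuationInequalities.

(** * Leading terms along a pseudo-limit *)

Section PseudoLimit.
Variables (K : fieldType) (L : fieldExtType K) (G : oagType).
Variables (v : valuation L G) (theta : L).

Definition offset (c : K) : L := in_alg L c - theta.
Local Notation t := offset.

Definition pseudo_limit := forall c, exists c', v (t c) < v (t c').

(** These conditions form a proper filter: values are totally ordered, and [c0]
    itself meets the threshold that it sets. *)
Definition ultimately (Q : K -> Prop) :=
  exists c0, forall c, v (t c0) <= v (t c) -> Q c.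

Lemma ultimately_all (Q : K -> Prop) : (forall c, Q c) -> ultimately Q.
Proof. by move=> QT; exists 0. Qed.

Lemma ultimately_mono (Q R : K -> Prop) :
  (forall c, Q c -> R c) -> ultimately Q -> ultimately R.
Proof. by move=> QR [c0 H]; exists c0 => c /H/QR. Qed.

Lemma ultimately_and (Q R : K -> Prop) :
  ultimately Q -> ultimately R -> ultimately (fun c => Q c /\ R c).
Proof.
move=> [c1 H1] [c2 H2]; case: (leP (v (t c1)) (v (t c2))) => [le12|/ltW le21].
  by exists c2 => c ?; split; [apply: H1; apply: le_trans le12 _|apply: H2].
by exists c1 => c ?; split; [apply: H1|apply: H2; apply: le_trans le21 _].
Qed.

Lemma ultimately_witness (Q : K -> Prop) : ultimately Q -> exists c, Q c.
Proof. by case=> c0 H; exists c0; apply: H. Qed.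

Hypothesis lim_theta : pseudo_limit.

Lemma offset_neq0 c : t c != 0.
Proof. by have [c'] := lim_theta c; apply: val_lt_neq0. Qed.

(** After cancelling [t c ^+ m], the value of [a] is compared with that of
    [b * t c ^+ k.+1], which strictly increases along the pseudo-limit: either
    the latter reaches the former and then exceeds it for good, or it always
    stays below. *)
Lemma ultimately_separated a b m n : a != 0 -> b != 0 -> (m < n)%N ->
  ultimately (fun c => v (a * t c ^+ m) < v (b * t c ^+ n)) \/
  ultimately (fun c => v (b * t c ^+ n) < v (a * t c ^+ m)).
Proof.
move=> a0 b0 mn.
have [k ->] : exists k, n = (m + k.+1)%N.
  by exists (n - m).-1; rewrite prednK ?subn_gt0 // subnKC // ltnW.
have swap c : b * t c ^+ (m + k.+1) = t c ^+ m * (b * t c ^+ k.+1).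
  by rewrite exprD mulrCA.
have tm0 c : t c ^+ m != 0 by rewrite expf_neq0 ?offset_neq0.
have [[c0 le0]|no] :=
    boolp.pselect (exists c0, v a <= v (b * t c0 ^+ k.+1)); last first.
  right; apply: ultimately_all => c; rewrite swap mulrC [a * _]mulrC.
  rewrite [X in v X < _]mulrC val_lt_mul2l // ltNge.
  by apply/negP => le0; apply: no; exists c.
left; have [c1 lt01] := lim_theta c0; exists c1 => c le1.
rewrite swap [a * _]mulrC val_lt_mul2l //; apply: le_lt_trans le0 _.
by rewrite val_lt_mul2l // val_ltX // (lt_le_trans lt01).
Qed.

(** Two terms of different degrees have values that are ultimately unequal, in
    a fixed order, so finitely many terms have ultimately one strict minimum. *)
Lemma ultimately_unique_min (a : nat -> L) n :
  (forall i, (i < n)%N -> a i = 0) \/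
  exists h, [/\ (h < n)%N, a h != 0 & ultimately (fun c => forall i,
    (i < n)%N -> i != h -> v (a h * t c ^+ h) < v (a i * t c ^+ i))].
Proof.
elim: n => [|n IH]; first by left.
have [an0|an0] := eqVneq (a n) 0.
  case: IH => [a0|[h [hn ah0 Hh]]].
    by left=> i; rewrite ltnS leq_eqVlt => /predU1P[->//|/a0].
  right; exists h; split=> //; first exact: ltnW.
  apply: ultimately_mono Hh => c Hc i.
  rewrite ltnS leq_eqVlt => /predU1P[->|/Hc//] _.
  have : a h * t c ^+ h != 0 by rewrite mulf_neq0 ?expf_neq0 ?offset_neq0.
  by case/(val_fin v) => g ->; rewrite an0 mul0r val0.
case: IH => [a0|[h [hn ah0 Hh]]].
  right; exists n; split=> //; apply: ultimately_all => c i.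
  rewrite ltnS leq_eqVlt => /orP[->//|/a0 ->] _.
  have : a n * t c ^+ n != 0 by rewrite mulf_neq0 ?expf_neq0 ?offset_neq0.
  by case/(val_fin v) => g ->; rewrite mul0r val0.
right; case: (ultimately_separated ah0 an0 hn) => Hn.
  exists h; split=> //; first exact: ltnW.
  apply: ultimately_mono (ultimately_and Hh Hn) => c [Hc Hnc] i.
  by rewrite ltnS leq_eqVlt => /predU1P[->|/Hc].
exists n; split=> //.
apply: ultimately_mono (ultimately_and Hh Hn) => c [Hc Hnc] i.
rewrite ltnS leq_eqVlt => /orP[->//|/Hc ltc] _.
have [->//|ih] := eqVneq i h.
exact: lt_trans Hnc (ltc ih).
Qed.

(** [F c] is asymptotic to the monomial [a * t c ^+ n]: their quotient is
    ultimately a unit with residue 1. For [n = 0] the values of [F] are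
    ultimately constant, equal to [v a]. *)
Definition leading (F : K -> L) (a : L) (n : nat) :=
  a != 0 /\ ultimately (fun c => v (a * t c ^+ n) < v (F c - a * t c ^+ n)).

Lemma leading_mul F F' a a' n n' :
  leading F a n -> leading F' a' n' ->
  leading (fun c => F c * F' c) (a * a') (n + n').
Proof.
move=> [a0 HF] [a'0 HF']; split; first by rewrite mulf_neq0.
apply: ultimately_mono (ultimately_and HF HF') => c [ltF ltF'].
have E : a * a' * t c ^+ (n + n') = (a * t c ^+ n) * (a' * t c ^+ n').
  by rewrite exprD mulrACA.
rewrite E; set x := a * _ in ltF E *; set y := a' * _ in ltF' E *.
have x0 : x != 0 by rewrite mulf_neq0 ?expf_neq0 ?offset_neq0.
have y0 : y != 0 by rewrite mulf_neq0 ?expf_neq0 ?offset_neq0.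
have -> : F c * F' c - x * y = (F' c - y) * x + F' c * (F c - x).
  by ring.
apply: val_ltD; first by rewrite [_ * x]mulrC val_lt_mul2l.
have F'0 : F' c != 0.
  apply/eqP => F'0; case/eqP: y0; apply/(val_eqinf v).
  by rewrite -(val_dominant ltF') F'0 val0.
have <- : v (F' c * x) = v (x * y).
  by rewrite mulrC Defs.valM (val_dominant ltF') -Defs.valM.
by rewrite val_lt_mul2l.
Qed.

(** Of two monomials of different degrees one ultimately has the smaller value,
    and it remains the leading term of the sum. *)
Lemma leading_add F F' a a' n n' : n != n' ->
  leading F a n -> leading F' a' n' ->
  leading (fun c => F c + F' c) a n \/ leading (fun c => F c + F' c) a' n'.
Proof.
have aux Q Q' b b' m m' : leading Q b m -> leading Q' b' m' ->
    ultimately (fun c => v (b * t c ^+ m) < v (b' * t c ^+ m')) ->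
    leading (fun c => Q c + Q' c) b m.
  move=> [b0 HQ] [_ HQ'] H; split=> //.
  apply: ultimately_mono (ultimately_and (ultimately_and HQ HQ') H).
  move=> c [[ltQ ltQ'] ltb]; rewrite addrAC; apply: val_ltD => //.
  by rewrite (val_dominant ltQ').
move=> nn' HF HF'; have [a0 _] := HF; have [a'0 _] := HF'.
have auxC := aux _ _ _ _ _ _ HF' HF.
have {}aux := aux _ _ _ _ _ _ HF HF'.
have {}auxC : ultimately (fun c => v (a' * t c ^+ n') < v (a * t c ^+ n)) ->
    leading (fun c => F c + F' c) a' n'.
  move=> /auxC[_ H]; split=> //; apply: ultimately_mono H => c.
  by rewrite [F' c + _]addrC.
by case: (ltngtP n n') nn' => // nn' _;
  [case: (ultimately_separated a0 a'0 nn')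
  |case: (ultimately_separated a'0 a0 nn')]; auto.
Qed.

Lemma leading_unique F a a' n n' : leading F a n -> leading F a' n' -> n = n'.
Proof.
move=> [a0 HF] [a'0 HF'].
have E : ultimately (fun c => v (a * t c ^+ n) = v (a' * t c ^+ n')).
  apply: ultimately_mono (ultimately_and HF HF') => c [ltF ltF'].
  by rewrite -(val_dominant ltF) (val_dominant ltF').
by case: (ltngtP n n') => // nn';
  [case: (ultimately_separated a0 a'0 nn')
  |case: (ultimately_separated a'0 a0 nn')];
  move=> /(ultimately_and E)/ultimately_witness[c []] ->; rewrite ltxx.
Qed.

Definition pvalue (f : {poly K}) (c : K) : L := in_alg L f.[c].

Lemma taylor (f : {poly K}) c : pvalue f c =
  \sum_(i < size f) (map_poly (in_alg L) f)^`N(i).[theta] * t c ^+ i.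
Proof.
rewrite /pvalue -horner_map -[X in _.[X]](subrKC theta) nderiv_taylor //.
  by rewrite size_map_poly.
exact: mulrC.
Qed.

(** The Taylor expansion at [theta] provides the leading term. It cannot be the
    top one when the degree [d.+1] is a unit for [v]: with leading coefficient
    [l], the next Taylor coefficient is [- l * d.+1 * t e] with [e] in [K], so
    the top term would beat it only while [v (t c) < v (t e)]. *)
Lemma leading_poly (f : {poly K}) : f != 0 ->
  exists h a, [/\ leading (pvalue f) a h, (h < size f)%N,
    h = 0%N -> a = (map_poly (in_alg L) f).[theta] &
    forall d, size f = d.+2 -> v d.+1%:R = fin 0 -> h != d.+1].
Proof.
move=> f0; pose fL := map_poly (in_alg L) f; pose a i := fL^`N(i).[theta].
have size_a i : (size fL^`N(i) <= size f - i)%N.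
  apply/leq_sizeP => j; rewrite leq_subLR => le_j.
  by rewrite coef_nderivn nth_default ?mul0rn ?size_map_poly.
have a_top : a (size f).-1 = in_alg L (lead_coef f).
  have f_gt0 : (0 < size f)%N by rewrite size_poly_gt0.
  rewrite /a (@horner_coef_wide _ 1) ?big_ord1; last first.
    by apply: leq_trans (size_a _) _; rewrite leq_subLR addn1 prednK.
  by rewrite coef_nderivn addn0 binn coef_map expr0 mulr1 mulr1n.
case: (ultimately_unique_min a (size f)) => [a0|[h [hf ah0 Hh]]].
  have := a0 (size f).-1; rewrite prednK ?size_poly_gt0 // a_top.
  move/(_ (leqnn _)).
  by move/eqP; rewrite fmorph_eq0 lead_coef_eq0 (negPf f0).
exists h, (a h); split=> //.
- split=> //; apply: ultimately_mono Hh => c Hc.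
  rewrite taylor (bigD1 (Ordinal hf)) //= -/(a h).
  rewrite [_ + \sum_(_ < _ | _) _]addrC addrK.
  apply: val_lt_sum.
    have : a h * t c ^+ h != 0 by rewrite mulf_neq0 ?expf_neq0 ?offset_neq0.
    by case/(val_fin v) => g ->.
  by move=> i ih; apply: Hc.
- by move=> ->; rewrite /a nderivn0.
move=> d sf vd; apply/eqP => hd.
have c1 : a d.+1 = in_alg L (lead_coef f) by rewrite -a_top sf.
set l := lead_coef f in c1.
have l0 : in_alg L l != 0 by rewrite fmorph_eq0 lead_coef_eq0.
have d0 : d.+1%:R != 0 :> L.
  by apply/eqP => d0; move: vd; rewrite d0 val0.
have dK0 : d.+1%:R != 0 :> K.
  by rewrite -(rmorph_nat (in_alg L)) fmorph_eq0 in d0.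
(* The root of the Hasse derivative of order [d] of [f], which is linear. *)
pose e := - (f`_d / (l * d.+1%:R)).
have ae : a d = - (in_alg L l * d.+1%:R * t e).
  rewrite /a (@horner_coef_wide _ 2); last first.
    by apply: leq_trans (size_a _) _; rewrite sf leq_subLR addn2.
  rewrite big_ord_recl big_ord1 !coef_nderivn /= !coef_map /= addn0 addn1.
  rewrite binn binSn expr0 expr1 mulr1n mulr1.
  rewrite -[f`_d.+1]/(f`_d.+2.-1) -sf -/(lead_coef f) -/l.
  rewrite /t /e rmorphN rmorphM fmorphV rmorphM rmorph_nat.
  rewrite -[in_alg L l *+ _]mulr_natr /=; move: l0; rewrite /=.
  move: (l%:A) ((f`_d)%:A) (d.+1%:R : L) d0 => x y z z0 x0.
  by field; rewrite z0 x0.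
(* The leading term being the top one would keep [t c] below [t e]. *)
have [c [lt_c le_c]] : exists c, v (t c) < v (t e) /\ v (t e) <= v (t c).
  apply: ultimately_witness; apply: ultimately_and; last by exists e.
  apply: ultimately_mono Hh => c /(_ d).
  rewrite sf hd ltnS leqnSn neq_ltn ltnSn /= => /(_ isT isT).
  have td0 : t c ^+ d != 0 by rewrite expf_neq0 ?offset_neq0.
  rewrite c1 exprS mulrA [_ * t c ^+ d]mulrC [a d * _]mulrC val_lt_mul2l //.
  rewrite ae Defs.valN -mulrA val_lt_mul2l //.
  by rewrite (Defs.valM v d.+1%:R) vd; case: (v (t e)) => //= g; rewrite add0r.
by move: lt_c; rewrite ltNge le_c.
Qed.

End PseudoLimit.

(** * Polynomials of degree less than p at an Artin-Schreier generator *)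

Section ArtinSchreier.
Variables (p : nat) (K : fieldType) (L : fieldExtType K) (G : oagType).
Variables (v : valuation L G) (theta : L) (a : K).
Hypothesis charK : p \in [pchar K].
Hypothesis thetaE : theta ^+ p - theta = in_alg L a.
Local Notation t := (offset theta).

Let p_prime : prime p. Proof. exact: pcharf_prime charK. Qed.
Let charL : p \in [pchar L]. Proof. by rewrite pchar_lalg. Qed.

Definition AS_poly : {poly K} := 'X^p - ('X + a%:P).

(** Additivity of the p-th power map turns the Artin-Schreier polynomial at [c]
    into the same expression [x ^ p - x] at [c - theta]. *)
Lemma AS_offset c : pvalue L AS_poly c = t c ^+ p - t c.
Proof.
rewrite /pvalue /AS_poly !hornerE /offset.
rewrite -(pFrobenius_autE charL) pFrobenius_autB_comm; last exact: mulrC.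
rewrite !pFrobenius_autE rmorphB rmorphD rmorphXn /= -[a%:A]thetaE.
by ring.
Qed.

Lemma size_AS_poly : size AS_poly = p.+1.
Proof.
by rewrite size_polyDl ?size_polyXn // size_polyN size_XaddC ltnS prime_gt1.
Qed.

Lemma val_AS_tail x : v x < fin 0 -> v (x ^+ p) < v x.
Proof.
rewrite -(Defs.val1 v) => x0; have [n ->] : exists n, p = n.+2.
  by exists p.-2; case: p p_prime => [|[]].
rewrite exprS -[X in _ < v X]mulr1 val_lt_mul2l ?(val_lt_neq0 x0) //.
by rewrite -(expr1n L n.+1) val_ltX.
Qed.

Lemma val_AS x : v x < fin 0 -> v (x ^+ p - x) = v (x ^+ p).
Proof.
by move=> x0; apply: val_dominant; rewrite addrC addKr Defs.valN val_AS_tail.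
Qed.

(** Nonzero integers satisfy [n ^ p = n], so they are roots of unity in [L], and
    value groups are torsion-free. *)
Lemma val_natr n : n%:R != 0 :> L -> v n%:R = fin 0.
Proof.
move=> n0; have [k Ek] : exists k, p = k.+2.
  by exists p.-2; case: p p_prime => [|[]].
have : n%:R ^+ k.+1 = 1 ^+ k.+1 :> L.
  apply: (mulfI n0); rewrite expr1n -exprS -Ek mulr1.
  by rewrite -(pFrobenius_autE charL) pFrobenius_aut_nat.
move=> E; rewrite -(Defs.val1 v); apply/eqP.
by rewrite eq_le -(val_le_expS v k) -(val_le_expS v k 1) E lexx.
Qed.

Hypothesis lim_theta : pseudo_limit v theta.
Hypothesis offset_lt0 : forall c, v (t c) < fin 0.

Lemma leading_AS : leading v theta (pvalue L AS_poly) 1 p.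
Proof.
split; first exact: oner_neq0.
apply: ultimately_all => c; rewrite mul1r AS_offset addrAC subrr add0r.
by rewrite Defs.valN val_AS_tail.
Qed.

(** The heart of the proof, by induction on the degree of [f]: a positive
    leading exponent [h] of [f] would, after division of the Artin-Schreier polynomial
    by [f], give that polynomial a leading exponent smaller than [p]. *)
Lemma leading_small (f : {poly K}) : f != 0 -> (size f <= p)%N ->
  leading v theta (pvalue L f) (map_poly (in_alg L) f).[theta] 0.
Proof.
have [n le_n] := ubnP (size f); elim: n f le_n => // n IH f le_n f0 le_p.
have [h [b [lead_f lt_h b0 not_top]]] := leading_poly lim_theta f0.
have [h0|h_gt0] := posnP h; first by move: lead_f; rewrite (b0 h0) h0.
have [d sf] : exists d, size f = d.+2.
  exists (size f).-2; move: (leq_ltn_trans h_gt0 lt_h).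
  by case: (size f) => [|[]].
have lt_dp : (d.+1 < p)%N by rewrite -sf.
have {not_top lt_h} le_hd : (h <= d)%N.
  rewrite -ltnS ltn_neqAle -ltnS -sf lt_h andbT not_top //.
  by rewrite val_natr // -(dvdn_pcharf charL) gtnNdvd.
set q := AS_poly %/ f; set r := AS_poly %% f.
have sq : size q = (p - d)%N by rewrite size_divp // size_AS_poly sf.
have q0 : q != 0 by rewrite -size_poly_gt0 sq subn_gt0 ltnW.
have [hq [bq [lead_q lt_hq _ _]]] := leading_poly lim_theta q0.
have lead_qf := leading_mul lim_theta lead_q lead_f.
have E c : pvalue L AS_poly c = pvalue L q c * pvalue L f c + pvalue L r c.
  by rewrite /pvalue {1}(divp_eq AS_poly f) hornerD hornerM rmorphD rmorphM.
have lead_sum : leading v theta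
    (fun c => pvalue L q c * pvalue L f c + pvalue L r c) 1 p.
  have [one0 H] := leading_AS; split=> //.
  by apply: ultimately_mono H => c; rewrite E.
(* [hq <= deg q] and [h < deg f] contradict [p = deg q + deg f]. *)
suff : p = (hq + h)%N \/ p = 0%N.
  case=> [ep|p0]; last by have := p_prime; rewrite p0.
  have : (d + hq < hq + h)%N by rewrite -ep -ltn_subRL -sq.
  by rewrite addnC ltn_add2l ltnNge le_hd.
have [r0|r0] := eqVneq r 0.
  left; apply: leading_unique lim_theta _ _ _ _ _ lead_sum _; last first.
  have [bb0 H] := lead_qf; split; first exact: bb0.
  apply: ultimately_mono H => c; rewrite r0 /pvalue horner0 rmorph0 addr0.
  exact.
have lt_r : (size r < size f)%N by rewrite ltn_modp.
have lead_r := IH r (leq_trans lt_r le_n) r0 (leq_trans (ltnW lt_r) le_p).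
have nz : (hq + h)%N != 0%N.
  by rewrite addn_eq0 negb_and -[h != _]lt0n h_gt0 orbT.
case: (leading_add lim_theta nz lead_qf lead_r) => lead'; [left|right];
  exact: leading_unique lim_theta _ _ _ _ _ lead_sum lead'.
Qed.

End ArtinSchreier.

Section Generation.
Variables (K : fieldType) (L : fieldExtType K) (theta : L).

Lemma generator_poly (y : L) : <<1; theta>>%VS = {:L}%VS ->
  exists2 f : {poly K},
    (size f <= \dim {:L})%N & (map_poly (in_alg L) f).[theta] = y.
Proof.
move=> gen; have := Fadjoin_polyOver 1 theta y.
case/polyOver1P=> f Ef; exists f.
  rewrite -gen (dim_Fadjoin 1) dimv1 muln1 -(size_map_poly (in_alg L)) -Ef.
  exact: size_Fadjoin_poly.
by rewrite -Ef; apply: (@Fadjoin_poly_eq _ _ 1%AS); rewrite gen memvf.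
Qed.

End Generation.

(** * Comparing two extensions of a valuation *)

Section Extensions.
Variables (K : fieldType) (L : fieldExtType K) (G G' : oagType).
Variables (v : valuation L G) (w : valuation L G').

(** Equivalence of the restrictions only speaks of valuation rings; the order of
    values is recovered by comparing the quotient [y / x] with 1. *)
Lemma val_base_le :
  val_equiv (val_restr (in_alg L) w) (val_base v) ->
  forall x y : K, (w (in_alg L x) <= w (in_alg L y)) =
                  (v (in_alg L x) <= v (in_alg L y)).
Proof.
move=> equiv x y; have [->|x0] := eqVneq x 0.
  rewrite rmorph0 !val0; have [->|y0] := eqVneq y 0.
    by rewrite rmorph0 !val0 !lexx.
  have : in_alg L y != 0 by rewrite fmorph_eq0.
  by move=> y0'; have [g ->] := val_fin v y0'; have [g' ->] := val_fin w y0'.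
have x0' : in_alg L x != 0 by rewrite fmorph_eq0.
have unitP (H : oagType) (u : valuation L H) :
    (u (in_alg L x) <= u (in_alg L y)) = (fin 0 <= u (in_alg L (x^-1 * y))).
  rewrite -(Defs.val1 u) -(val_le_mul2l u 1 _ x0') mulr1.
  by rewrite -[_ * _](rmorphM (in_alg L)) mulVKf.
rewrite !unitP.
exact: equiv (x^-1 * y).
Qed.

Lemma ultimately_transfer theta (Q : K -> Prop) :
  (forall c c', (w (offset theta c) <= w (offset theta c')) =
                (v (offset theta c) <= v (offset theta c'))) ->
  ultimately w theta Q -> ultimately v theta Q.
Proof. by move=> E [c0 H]; exists c0 => c; rewrite -E; apply: H. Qed.

End Extensions.

(** * Immediacy and defect from approximation *)

Section ImmediateExtensions.
Variables (K : fieldType) (L : fieldExtType K) (G : oagType).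
Variable v : valuation L G.

(** If [v (x - y) > v y] then [v x = v y], and when this value is 0 the residue
    of [x - y] vanishes. *)
Lemma immediate_of_approx :
  (forall y : L, y != 0 -> exists c : K, v y < v (in_alg L c - y)) ->
  immediate v.
Proof.
move=> approx; split.
  move=> g [y vy]; have y0 : y != 0.
    by apply/eqP => y0; move: vy; rewrite y0 val0.
  by have [c /val_dominant vc] := approx y y0; exists c; rewrite /= vc.
elim/quotW=> u; rewrite -/(residue v u).
have [u0|u_unit] := eqVneq (residue v u) 0.
  by exists 0; rewrite rmorph0.
have vu : v (vring_val u) = fin 0 by apply: val_unit; rewrite -residue_eq0.
have y0 : vring_val u != 0.
  by apply/eqP => y0; move: vu; rewrite y0 val0.
have [c ltc] := approx _ y0.
have c_int : c \in vring_pred (val_base v).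
  by rewrite inE /= (val_dominant ltc) vu.
exists (residue _ (VRing c_int)); rewrite resfield_mapE.
by apply/eqP; rewrite -subr_eq0 -rmorphB residue_eq0 inE /= -vu.
Qed.

Lemma immediate_defect : immediate v -> is_defect v (\dim {:L})%:R.
Proof.
move=> [same_group same_field]; exists 1%N, 1%N; split.
- exists (fun=> 0) => [_|g /same_group vKg]; first by exists 1; apply: Defs.val1.
  exists ord0; split=> [|i _]; last exact/esym/ord1.
  by rewrite /= subr0.
- exists (fun=> 1) => y; have [x <-] := same_field y; exists [ffun=> x].
  split=> [|c]; rewrite big_ord1 mulr1 ?ffunE // => /fmorph_inj ->.
  by apply/ffunP => i; rewrite ffunE (ord1 i).
by rewrite muln1 divr1.
Qed.

End ImmediateExtensions.

(** * Artin-Schreier extensions generated by a pseudo-limit *)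

Section ArtinSchreierApproximation.
Variables (p : nat) (K : fieldType) (L : fieldExtType K) (G : oagType).
Variables (v : valuation L G) (theta : L) (a : K).
Hypotheses (charK : p \in [pchar K]) (dimL : \dim {:L} = p).
Hypothesis thetaE : theta ^+ p - theta = in_alg L a.
Hypothesis gen : <<1; theta>>%VS = {:L}%VS.
Hypothesis lim_theta : pseudo_limit v theta.
Hypothesis offset_lt0 : forall c, v (offset theta c) < fin 0.

Lemma ultimately_approx (f : {poly K}) (y : L) :
    (size f <= p)%N -> (map_poly (in_alg L) f).[theta] = y -> y != 0 ->
  ultimately v theta (fun c => v y < v (in_alg L f.[c] - y)).
Proof.
move=> le_p fy y0; have f0 : f != 0.
  by apply: contraNneq y0 => f0; rewrite -fy f0 rmorph0 horner0.
have [_] := leading_small charK thetaE lim_theta offset_lt0 f0 le_p.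
by apply: ultimately_mono => c; rewrite expr0 mulr1 fy.
Qed.

Lemma AS_immediate : immediate v.
Proof.
apply: immediate_of_approx => y y0.
have [f le_p fy] := generator_poly y gen; rewrite dimL in le_p.
by have [c] := ultimately_witness (ultimately_approx le_p fy y0); exists f.[c].
Qed.

End ArtinSchreierApproximation.

Section ArtinSchreierUniqueness.
Variables (p : nat) (K : fieldType) (L : fieldExtType K) (G : oagType).
Variables (v : valuation L G) (theta : L) (a : K).
Hypotheses (charK : p \in [pchar K]) (dimL : \dim {:L} = p).
Hypothesis thetaE : theta ^+ p - theta = in_alg L a.
Hypothesis gen : <<1; theta>>%VS = {:L}%VS.
Hypothesis lim_theta : pseudo_limit v theta.
Hypothesis offset_lt0 : forall c, v (offset theta c) < fin 0.

(** Every [t c ^+ p - t c] lies in [K], where [v] and [w] agree. As [v (t c)]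
    is negative, these elements control [t c] for both valuations, so [theta]
    is a pseudo-limit with the same notion of ultimately for [w] as for [v]. *)
Lemma AS_unique_extension : unique_extension v.
Proof.
move=> G' w equiv; have base_le := val_base_le equiv.
have ASE c := AS_offset charK thetaE c.
have w_lt0 c : w (offset theta c) < fin 0.
  rewrite ltNge; apply/negP => w_ge0.
  have : fin 0 <= w (pvalue L (AS_poly p a) c).
    (* The elements of nonnegative value for [w] form a subring. *)
    have int_t : offset theta c \in vring_pred w by [].
    rewrite ASE; change (offset theta c ^+ p - offset theta c \in vring_pred w).
    by rewrite rpredB ?rpredX.
  have := equiv (AS_poly p a).[c]; rewrite !inE /= => ->.
  rewrite -[_%:A]/(pvalue L (AS_poly p a) c) ASE (val_AS charK) // leNgt.
  by rewrite (lt_trans (val_AS_tail charK (offset_lt0 c))).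
have order c c' : (w (offset theta c) <= w (offset theta c')) =
                  (v (offset theta c) <= v (offset theta c')).
  have [k Ek] : exists k, p = k.+1.
    by exists p.-1; rewrite prednK ?prime_gt0 ?(pcharf_prime charK).
  rewrite -(val_le_expS w k) -(val_le_expS v k) -Ek.
  by rewrite -!(val_AS charK) // -!ASE; apply: base_le.
have lim_w : pseudo_limit w theta.
  by move=> c; have [c' lt_c] := lim_theta c; exists c';
    rewrite ltNge order -ltNge.
move=> y; rewrite !inE; have [->|y0] := eqVneq y 0; first by rewrite !val0.
have [f le_p fy] := generator_poly y gen; rewrite dimL in le_p.
have approx_v := ultimately_approx charK thetaE lim_theta offset_lt0 le_p fy y0.
have approx_w := ultimately_approx charK thetaE lim_w w_lt0 le_p fy y0.
have [c [lt_v lt_w]] := ultimately_witness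
  (ultimately_and approx_v (ultimately_transfer order approx_w)).
rewrite -(val_dominant lt_v) -(val_dominant lt_w).
by have := equiv f.[c]; rewrite !inE.
Qed.

End ArtinSchreierUniqueness.

(** * Reading the hypotheses on the distance *)

Section Distance.
Variables (K : fieldType) (L : fieldExtType K) (G : oagType).
Variables (v : valuation L G) (theta : L).

Lemma diff_values_offset c : diff_values v theta (v (offset theta c)).
Proof. by exists c => //; rewrite -Defs.valN opprB. Qed.

Lemma pseudo_limit_of_no_max :
  ~ has_maximal (diff_values v theta) -> pseudo_limit v theta.
Proof.
move=> no_max c; apply: boolp.contrapT => no_c'; apply: no_max.
exists (v (offset theta c)); first exact: diff_values_offset.
move=> _ [c' _ <-] lt_c; apply: no_c'; exists c'.
by rewrite -(Defs.valN v (offset theta c')) [X in - X]/offset opprB.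
Qed.

(** The distance sees only values in the divisible hull of [vK]; every
    [v (t c)] lies in [vK] itself, because a closer [c'] gives
    [v (t c) = v (c - c')]. *)
Lemma offset_lt0_of_dist : pseudo_limit v theta ->
    cut_le (dist v theta) (minus_cut (hull_base v) 0) ->
  forall c, v (offset theta c) < fin 0.
Proof.
move=> lim_theta dist_le c; have [c' lt_c] := lim_theta c.
have [g vg] := val_fin v (offset_neq0 lim_theta c).
have v_diff : v (in_alg L (c - c')) = fin g.
  rewrite -vg; apply: val_dominant.
  by rewrite (_ : _ - _ = - offset theta c') ?Defs.valN // rmorphB /offset; ring.
have hull_g : hull_base v (inhull g) by exists 0%N, g => //; exists (c - c').
have /dist_le[_] : lower_cut (dist v theta) (inhull g).
  split=> // A _; apply; split=> //; exists g => //=; rewrite -vg.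
  exact: diff_values_offset.
by rewrite vg fin_lt -(raddf0 (@inhull G)) !ltNge inhull_le.
Qed.

End Distance.

Theorem lemma5p1 (p : nat) (K : fieldType) (L : splittingFieldType K)
    (G : oagType) (v : valuation L G) (theta : L)
    (hchar : p \in [pchar K])
    (hAS : artin_schreier_extension p L)
    (htheta : artin_schreier_generator p theta)
    (hdist : cut_le (dist v theta) (minus_cut (hull_base v) 0))
    (hmax : ~ has_maximal (diff_values v theta)) :
  [/\ unique_extension v, immediate v & is_defect v p%:R].
Proof.
have [_ _ dimL] := hAS; have [gen /vlineP[a thetaE]] := htheta.
have lim_theta := pseudo_limit_of_no_max hmax.
have offset_lt0 := offset_lt0_of_dist lim_theta hdist.
have imm := AS_immediate hchar dimL thetaE gen lim_theta offset_lt0.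
split=> //; last by rewrite -dimL; apply: immediate_defect.
exact: AS_unique_extension hchar dimL thetaE gen lim_theta offset_lt0.
Qed.
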